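(* (In $\mathbf{ZF}$.) Every $F_\sigma$-subspace of a Loeb space is Loeb.
   Context: The result is a theorem of $\mathbf{ZF}$ (Zermelo–Fraenkel set theory without the axiom of choice). A topological space is Loeb if the family of all its non-empty closed subsets has a choice function. An $F_\sigma$-subspace is a subspace whose underlying set is a countable union of closed sets of the space. *)

(* Defs.v *)
(* Vanilla Rocq (no library needed).

   The metatheory may have choice, so topological spaces cannot be carried by
   Rocq types here: every type-based space would be Loeb.  Instead, "in ZF" is
   rendered by an arbitrary structure (V, ∈) satisfying the first-order ZF
   axioms, and every notion is stated inside V, quantifying over elements of V
   only.  In particular choice functions, enumerations and topologies are
   elements of V. *)

Set Implicit Arguments.
Unset Strict Implicit.

Record set_structure : Type := SetStructure {
  carrier :> Type;
  mem : carrier -> carrier -> Prop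
}.

Declare Scope zf_scope.
Delimit Scope zf_scope with zf.
Notation "x ∈ y" := (mem x y) (at level 70, no associativity) : zf_scope.
Notation "x ∉ y" := (~ mem x y) (at level 70, no associativity) : zf_scope.
Open Scope zf_scope.

(* Formulas of the language {∈, =} with de Bruijn variables.  They are needed
   because Separation and Replacement must range over first-order formulas with
   parameters: ranging over all Rocq predicates would let choice in the
   metatheory leak into V. *)
Inductive formula : Type :=
| FMem (i j : nat)
| FEq (i j : nat)
| FFalse
| FNot (p : formula)
| FAnd (p q : formula)
| FOr (p q : formula)
| FImp (p q : formula)
| FIff (p q : formula)
| FAll (p : formula)
| FEx (p : formula).

Definition scons (T : Type) (a : T) (rho : nat -> T) (n : nat) : T :=
  match n with
  | O => a
  | S m => rho m
  end.

Fixpoint sat (V : set_structure) (rho : nat -> V) (p : formula) : Prop :=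
  match p with
  | FMem i j => rho i ∈ rho j
  | FEq i j => rho i = rho j
  | FFalse => False
  | FNot p => ~ sat rho p
  | FAnd p q => sat rho p /\ sat rho q
  | FOr p q => sat rho p \/ sat rho q
  | FImp p q => sat rho p -> sat rho q
  | FIff p q => sat rho p <-> sat rho q
  | FAll p => forall a : V, sat (scons a rho) p
  | FEx p => exists a : V, sat (scons a rho) p
  end.

Section SetNotions.

Variable V : set_structure.
Implicit Types x y z a b c f p s w u A C D F K O T X : V.

Definition subset x y : Prop := forall z, z ∈ x -> z ∈ y.

Definition is_empty x : Prop := forall z, z ∉ x.

Definition nonempty x : Prop := exists z, z ∈ x.

Definition is_upair p a b : Prop := forall z, z ∈ p <-> z = a \/ z = b.

(* Kuratowski pair {{a}, {a, b}} *)
Definition is_opair p a b : Prop :=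
  exists s d : V, is_upair s a a /\ is_upair d a b /\ is_upair p s d.

Definition is_union u F : Prop := forall z, z ∈ u <-> exists x, x ∈ F /\ z ∈ x.

Definition is_inter2 c a b : Prop := forall z, z ∈ c <-> z ∈ a /\ z ∈ b.

Definition is_diff c a b : Prop := forall z, z ∈ c <-> z ∈ a /\ z ∉ b.

Definition is_powerset p a : Prop := forall z, z ∈ p <-> subset z a.

Definition is_succ s x : Prop := forall z, z ∈ s <-> z ∈ x \/ z = x.

Definition inductive_set w : Prop :=
  (exists e : V, is_empty e /\ e ∈ w) /\
  (forall x, x ∈ w -> exists s, is_succ s x /\ s ∈ w).

Definition is_omega w : Prop :=
  inductive_set w /\ (forall w', inductive_set w' -> subset w w').

Record ZF : Prop := {
  zf_extensionality : forall x y, (forall z, z ∈ x <-> z ∈ y) -> x = y;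
  zf_foundation : forall x, nonempty x ->
    exists y, y ∈ x /\ forall z, z ∈ y -> z ∉ x;
  zf_pairing : forall a b, exists p, is_upair p a b;
  zf_union : forall F, exists u, is_union u F;
  zf_powerset : forall a, exists p, is_powerset p a;
  zf_infinity : exists w, inductive_set w;
  zf_separation : forall (phi : formula) (rho : nat -> V) a,
    exists b, forall x, x ∈ b <-> x ∈ a /\ sat (scons x rho) phi;
  (* in phi, variable 0 is the argument x and variable 1 its image y *)
  zf_replacement : forall (phi : formula) (rho : nat -> V) a,
    (forall x y y', x ∈ a ->
       sat (scons x (scons y rho)) phi -> sat (scons x (scons y' rho)) phi ->
       y = y') ->
    exists b, forall y,
      y ∈ b <-> exists x, x ∈ a /\ sat (scons x (scons y rho)) phi
}.

Definition maps f x y : Prop := exists p, is_opair p x y /\ p ∈ f.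

Definition is_function f D : Prop :=
  (forall p, p ∈ f -> exists x y, x ∈ D /\ is_opair p x y) /\
  (forall x, x ∈ D -> exists y, maps f x y) /\
  (forall x y y', maps f x y -> maps f x y' -> y = y').

(* countable means finite or countably infinite: equipotent to a subset of ω *)
Definition countable C : Prop :=
  exists w f, is_omega w /\ is_function f C /\
    (forall x n, maps f x n -> n ∈ w) /\
    (forall x x' n, maps f x n -> maps f x' n -> x = x').

Definition is_choice_function f F : Prop :=
  is_function f F /\ (forall C c, maps f C c -> c ∈ C).

Definition is_topology X T : Prop :=
  (forall O, O ∈ T -> subset O X) /\
  (forall e : V, is_empty e -> e ∈ T) /\
  X ∈ T /\
  (forall F u, subset F T -> is_union u F -> u ∈ T) /\
  (forall O O' c, O ∈ T -> O' ∈ T -> is_inter2 c O O' -> c ∈ T).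

Definition is_closed X T C : Prop :=
  subset C X /\ exists O, O ∈ T /\ is_diff O X C.

Definition is_subspace_topology A T TA : Prop :=
  forall O, O ∈ TA <-> exists U : V, U ∈ T /\ is_inter2 O A U.

Definition is_Fsigma X T A : Prop :=
  exists F, countable F /\ (forall C, C ∈ F -> is_closed X T C) /\
    is_union A F.

Definition is_Loeb X T : Prop :=
  exists F, (forall C, C ∈ F <-> is_closed X T C /\ nonempty C) /\
    exists f, is_choice_function f F.

End SetNotions.

(* Main.v *)
Require Import Defs.
From Stdlib Require Import Classical.

(** Write the F_sigma set as A = ⋃F with every K ∈ F closed in X, let g : F → ω
    be an injection, and let f be a choice function for the non-empty closed
    subsets of X.  Given a non-empty C closed in A, some K ∈ F meets C; take the
    one with the least index g(K).  Since K ⊆ A is closed in X and C is the trace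
    on A of a closed subset of X, the set K ∩ C is closed in X
    ([closed_inter_subspace]), hence f(K ∩ C) is defined, and it is an element
    of C.  So C ↦ f(K ∩ C) is a choice function.

    No choice is involved because the least index is unique: the indices form
    a non-empty subset of ω, which has an ∈-minimal element by Foundation, and
    ∈ is trichotomous on ω ([omega_trichotomy]).  The map itself is an element
    of V by Replacement, since [selects] is expressed by a formula.  Formulas
    below are written so that [sat] reduces definitionally to the notion that
    they express. *)

Set Implicit Arguments.
Unset Strict Implicit.

(** * Formulas for the basic notions *)

(* Each argument is the de Bruijn index of the variable standing for it. *)

Definition f_subset (x y : nat) : formula :=
  FAll (FImp (FMem 0 (S x)) (FMem 0 (S y))).

Definition f_nonempty (x : nat) : formula := FEx (FMem 0 (S x)).

Definition f_upair (p a b : nat) : formula :=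
  FAll (FIff (FMem 0 (S p)) (FOr (FEq 0 (S a)) (FEq 0 (S b)))).

Definition f_opair (p a b : nat) : formula :=
  FEx (FEx (FAnd (f_upair 1 (S (S a)) (S (S a)))
           (FAnd (f_upair 0 (S (S a)) (S (S b)))
                 (f_upair (S (S p)) 1 0)))).

Definition f_inter2 (c a b : nat) : formula :=
  FAll (FIff (FMem 0 (S c)) (FAnd (FMem 0 (S a)) (FMem 0 (S b)))).

Definition f_diff (c a b : nat) : formula :=
  FAll (FIff (FMem 0 (S c)) (FAnd (FMem 0 (S a)) (FNot (FMem 0 (S b))))).

Definition f_succ (s x : nat) : formula :=
  FAll (FIff (FMem 0 (S s)) (FOr (FMem 0 (S x)) (FEq 0 (S x)))).

Definition f_maps (f x y : nat) : formula :=
  FEx (FAnd (f_opair 0 (S x) (S y)) (FMem 0 (S f))).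

Definition f_closed (X T C : nat) : formula :=
  FAnd (f_subset C X)
       (FEx (FAnd (FMem 0 (S T)) (f_diff 0 (S X) (S C)))).

(** [meets K C]: the sets K and C have a common element. *)
Definition meets (V : set_structure) (K C : V) : Prop :=
  exists z, z ∈ K /\ z ∈ C.

Definition f_meets (K C : nat) : formula :=
  FEx (FAnd (FMem 0 (S K)) (FMem 0 (S C))).

(** [selects F g f C c]: c is the value of f at K ∩ C, where K is a member of F
    meeting C whose index under g is ∈-minimal among those of all such members. *)
Definition selects (V : set_structure) (F g f C c : V) : Prop :=
  exists K, K ∈ F /\ meets K C /\
    (exists n, maps g K n /\
       forall K' n', K' ∈ F -> maps g K' n' -> n' ∈ n -> ~ meets K' C) /\
    exists B, is_inter2 B K C /\ maps f B c.

Definition f_selects (F g f C c : nat) : formula :=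
  FEx (FAnd (FMem 0 (S F)) (FAnd (f_meets 0 (S C)) (FAnd
    (FEx (FAnd (f_maps (2 + g) 1 0)
       (FAll (FAll (FImp (FMem 1 (4 + F)) (FImp (f_maps (4 + g) 1 0)
          (FImp (FMem 0 2) (FNot (f_meets 1 (4 + C))))))))))
    (FEx (FAnd (f_inter2 0 1 (2 + C)) (f_maps (2 + f) 0 (2 + c))))))).

Section ZFTheory.

Variable V : set_structure.
Hypothesis HZF : ZF V.

(** * Ordered pairs *)

Lemma upair_unique (p p' a b : V) : is_upair p a b -> is_upair p' a b -> p = p'.
Proof.
  intros Hp Hp'; apply (zf_extensionality HZF); intro z.
  rewrite (Hp z), (Hp' z); tauto.
Qed.

Lemma opair_exists (a b : V) : exists p, is_opair p a b.
Proof.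
  destruct (zf_pairing HZF a a) as [s Hs].
  destruct (zf_pairing HZF a b) as [d Hd].
  destruct (zf_pairing HZF s d) as [p Hp].
  exists p, s, d; auto.
Qed.

Lemma opair_unique (p p' a b : V) : is_opair p a b -> is_opair p' a b -> p = p'.
Proof.
  intros [s [d [Hs [Hd Hp]]]] [s' [d' [Hs' [Hd' Hp']]]].
  rewrite (upair_unique Hs' Hs), (upair_unique Hd' Hd) in Hp'.
  exact (upair_unique Hp Hp').
Qed.

Lemma upair_inj (p a b b' : V) : is_upair p a b -> is_upair p a b' -> b = b'.
Proof.
  intros H H'.
  assert (Hb : b = a \/ b = b') by (apply H', H; auto).
  assert (Hb' : b' = a \/ b' = b) by (apply H, H'; auto).
  destruct Hb, Hb'; congruence.
Qed.

Lemma opair_inj (p a b a' b' : V) :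
  is_opair p a b -> is_opair p a' b' -> a = a' /\ b = b'.
Proof.
  intros [s [d [Hs [Hd Hp]]]] [s' [d' [Hs' [Hd' Hp']]]].
  assert (Ha : a = a').
  { (* a' lies in every member of p, in particular in {a} *)
    assert (E : s = s' \/ s = d') by (apply Hp', Hp; auto).
    assert (Ha' : a' ∈ s).
    { destruct E as [-> | ->]; [apply Hs' | apply Hd']; auto. }
    apply Hs in Ha'; destruct Ha'; congruence. }
  subst a'; split; [reflexivity |].
  rewrite (upair_unique Hs' Hs) in Hp'.
  rewrite (upair_inj Hp' Hp) in Hd'.
  exact (upair_inj Hd Hd').
Qed.

Lemma inter2_exists (a b : V) : exists c, is_inter2 c a b.
Proof.
  destruct (zf_separation HZF (FMem 0 1) (fun _ => b) a) as [c Hc].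
  exists c; exact Hc.
Qed.

Lemma inter2_unique (c c' a b : V) :
  is_inter2 c a b -> is_inter2 c' a b -> c = c'.
Proof.
  intros H H'; apply (zf_extensionality HZF); intro z.
  rewrite (H z), (H' z); tauto.
Qed.

(** * The natural numbers *)

Lemma omega_ind (w : V) (phi : formula) (rho : nat -> V) :
  is_omega w ->
  (forall e, is_empty e -> e ∈ w -> sat (scons e rho) phi) ->
  (forall x s, x ∈ w -> sat (scons x rho) phi -> is_succ s x -> s ∈ w ->
     sat (scons s rho) phi) ->
  forall n, n ∈ w -> sat (scons n rho) phi.
Proof.
  intros [[[e [He Hew]] Hsucc] Hleast] H0 HS n Hn.
  destruct (zf_separation HZF phi rho w) as [b Hb].
  apply (Hb n), (Hleast b); [split | exact Hn].
  - exists e; split; [exact He |]; apply Hb; auto.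
  - intros x Hx; apply Hb in Hx; destruct Hx as [Hxw Hx].
    destruct (Hsucc x Hxw) as [s [Hs Hsw]].
    exists s; split; [exact Hs |]; apply Hb; eauto.
Qed.

(** Least element, [omega_empty_le], and successor step, [omega_succ_le], are the
    two cases of the induction for trichotomy. *)
Lemma omega_empty_le (w e m : V) :
  is_omega w -> is_empty e -> m ∈ w -> e = m \/ e ∈ m.
Proof.
  intros Hw He.
  apply (omega_ind (phi := FOr (FEq 1 0) (FMem 1 0)) (rho := fun _ => e) Hw);
    simpl.
  - intros e' He' _; left; apply (zf_extensionality HZF); intro z.
    split; intro Hz; [destruct (He z Hz) | destruct (He' z Hz)].
  - intros x s _ Hx Hs _; right; apply Hs; tauto.
Qed.

Lemma omega_succ_le (w m : V) :
  is_omega w -> m ∈ w ->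
  forall n s, n ∈ m -> is_succ s n -> s = m \/ s ∈ m.
Proof.
  intro Hw; revert m.
  apply (omega_ind
    (phi := FAll (FAll (FImp (FMem 1 2) (FImp (f_succ 0 1)
              (FOr (FEq 0 2) (FMem 0 2))))))
    (rho := fun _ => w) Hw); simpl.
  - intros e He _ n s Hn; destruct (He n Hn).
  - intros x t _ IH Ht _ n s Hn Hs; apply Ht in Hn; destruct Hn as [Hn | ->].
    + right; apply Ht; destruct (IH n s Hn Hs); auto.
    + left; apply (zf_extensionality HZF); intro z.
      rewrite (Ht z); exact (Hs z).
Qed.

Lemma omega_trichotomy (w n m : V) :
  is_omega w -> n ∈ w -> m ∈ w -> m ∈ n \/ m = n \/ n ∈ m.
Proof.
  intros Hw Hn; revert m; revert n Hn.
  apply (omega_ind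
    (phi := FAll (FImp (FMem 0 2)
              (FOr (FMem 0 1) (FOr (FEq 0 1) (FMem 1 0)))))
    (rho := fun _ => w) Hw); simpl.
  - intros e He _ m Hm; destruct (omega_empty_le Hw He Hm); auto.
  - intros x s _ IH Hs _ m Hm.
    destruct (IH m Hm) as [H | [H | H]].
    + left; apply Hs; auto.
    + left; apply Hs; auto.
    + destruct (omega_succ_le Hw Hm H Hs); auto.
Qed.

(** * Closed sets of a subspace *)

(** The set C, closed in A only, becomes closed in X once it is cut down to a
    subset K of A that is closed in X. *)
Lemma closed_inter_subspace (X T A TA K C B : V) :
  is_topology X T -> is_subspace_topology A T TA ->
  is_closed X T K -> subset K A -> is_closed A TA C -> is_inter2 B K C ->
  is_closed X T B.
Proof.
  intros (HTX & _ & _ & HTU & _) HTA [HKX [O' [HO' HdK]]] HKA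
    [HCA [O [HO HdC]]] HB.
  apply HTA in HO; destruct HO as [U [HU HOU]].
  split.
  { intros z Hz; apply HKX, (proj1 (HB z) Hz). }
  (* the complement of K ∩ C in X is (X \ K) ∪ U, where A \ C = A ∩ U *)
  destruct (zf_pairing HZF O' U) as [P HP].
  destruct (zf_union HZF P) as [u Hu].
  exists u; split.
  - apply (HTU P); [| exact Hu].
    intros z Hz; apply HP in Hz; destruct Hz as [-> | ->]; assumption.
  - intro z; rewrite (Hu z); split.
    + intros [Y [HY Hz]]; apply HP in HY; destruct HY as [-> | ->].
      * apply HdK in Hz; destruct Hz as [HzX HzK]; split; [exact HzX |].
        intro HzB; apply HB in HzB; tauto.
      * split; [exact (HTX U HU z Hz) |].
        intro HzB; apply HB in HzB; destruct HzB as [HzK HzC].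
        assert (HzO : z ∈ O) by (apply HOU; auto).
        apply HdC in HzO; tauto.
    + intros [HzX HzB]; destruct (classic (z ∈ K)) as [HzK | HzK].
      * exists U; split; [apply HP; auto |].
        apply HOU, HdC; split; [exact (HKA z HzK) |].
        intro HzC; apply HzB, HB; auto.
      * exists O'; split; [apply HP; auto |].
        apply HdK; auto.
Qed.

(** * The selection *)

Lemma selects_mem (F g f D C c : V) :
  is_choice_function f D -> selects F g f C c -> c ∈ C.
Proof.
  intros [_ Hf] [K [_ [_ [_ [B [HB Hc]]]]]].
  exact (proj2 (proj1 (HB c) (Hf B c Hc))).
Qed.

Lemma selects_unique (w F g f D C c c' : V) :
  is_omega w -> (forall K n, maps g K n -> n ∈ w) ->
  (forall K K' n, maps g K n -> maps g K' n -> K = K') ->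
  is_function f D ->
  selects F g f C c -> selects F g f C c' -> c = c'.
Proof.
  intros Hw Hgw Hginj [_ [_ Hf]]
    [K [HK [HKC [[n [Hn Hmin]] [B [HB Hc]]]]]]
    [K' [HK' [HKC' [[n' [Hn' Hmin']] [B' [HB' Hc']]]]]].
  assert (E : n = n').
  { destruct (omega_trichotomy Hw (Hgw K n Hn) (Hgw K' n' Hn'))
      as [H | [H | H]].
    - destruct (Hmin K' n' HK' Hn' H HKC').
    - auto.
    - destruct (Hmin' K n HK Hn H HKC). }
  subst n'; pose proof (Hginj _ _ _ Hn Hn'); subst K'.
  rewrite (inter2_unique HB' HB) in Hc'; exact (Hf B c c' Hc Hc').
Qed.

Lemma selects_exists (w F g f D C : V) :
  is_function g F -> (forall K n, maps g K n -> n ∈ w) ->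
  is_function f D ->
  (forall K B, K ∈ F -> meets K C -> is_inter2 B K C -> B ∈ D) ->
  (exists K, K ∈ F /\ meets K C) ->
  exists c, selects F g f C c.
Proof.
  intros [_ [Hg _]] Hgw [_ [Hf _]] HD [K0 [HK0 HKC0]].
  (* the set of indices of the members of F that meet C *)
  destruct (zf_separation HZF
    (FEx (FAnd (FMem 0 2) (FAnd (f_maps 3 0 1) (f_meets 0 4))))
    (scons F (scons g (fun _ => C))) w) as [I HI].
  change (forall n, n ∈ I <-> n ∈ w /\
    exists K, K ∈ F /\ maps g K n /\ meets K C) in HI.
  destruct (Hg K0 HK0) as [n0 Hn0].
  destruct (zf_foundation HZF (x := I)) as [n [Hn Hmin]].
  { exists n0; apply HI; split; [exact (Hgw _ _ Hn0) | exists K0; auto]. }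
  apply HI in Hn; destruct Hn as [_ [K [HK [HKn HKC]]]].
  destruct (inter2_exists K C) as [B HB].
  destruct (Hf B (HD K B HK HKC HB)) as [c Hc].
  exists c, K; repeat split; try assumption.
  - exists n; split; [exact HKn |].
    intros K' n' HK' Hn' Hlt HKC'.
    apply (Hmin n' Hlt), HI; split; [exact (Hgw _ _ Hn') | exists K'; auto].
  - exists B; auto.
Qed.

(** If [selects] holds of exactly one value for each C in E, and that value lies
    in C, then by Replacement the pairs (C, c) form a choice function on E. *)
Lemma choice_function_of_selects (F g f E : V) :
  (forall C, C ∈ E -> exists c, selects F g f C c) ->
  (forall C c c', selects F g f C c -> selects F g f C c' -> c = c') ->
  (forall C c, selects F g f C c -> c ∈ C) ->
  exists h, is_choice_function h E.
Proof.
  intros Hex Huniq Hmem.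
  set (phi := FEx (FAnd (f_opair 2 1 0) (f_selects 3 4 5 1 0))).
  set (rho := scons F (scons g (fun _ => f))).
  assert (Hphi : forall C p, sat (scons C (scons p rho)) phi <->
            exists c, is_opair p C c /\ selects F g f C c)
    by (intros C p; reflexivity).
  destruct (zf_replacement HZF (phi := phi) (rho := rho) (a := E)) as [h Hh].
  { intros C p p' _ H H'.
    apply Hphi in H; apply Hphi in H'.
    destruct H as [c [Hp Hc]], H' as [c' [Hp' Hc']].
    rewrite (Huniq C c' c Hc' Hc) in Hp'; exact (opair_unique Hp Hp'). }
  assert (Hmaps : forall C c, maps h C c -> selects F g f C c).
  { intros C c [p [Hp Hph]]; apply Hh in Hph.
    destruct Hph as [C' [_ H]]; apply Hphi in H; destruct H as [c' [Hp' Hc']].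
    destruct (opair_inj Hp Hp'); subst; exact Hc'. }
  exists h; split; [split; [| split] |].
  - intros p Hp; apply Hh in Hp; destruct Hp as [C [HC H]].
    apply Hphi in H; destruct H as [c [Hp _]]; exists C, c; auto.
  - intros C HC; destruct (Hex C HC) as [c Hc].
    destruct (opair_exists C c) as [p Hp].
    exists c, p; split; [exact Hp |].
    apply Hh; exists C; split; [exact HC |]; apply Hphi; exists c; auto.
  - intros C c c' H H'; exact (Huniq C c c' (Hmaps _ _ H) (Hmaps _ _ H')).
  - intros C c H; exact (Hmem C c (Hmaps _ _ H)).
Qed.

Lemma nonempty_closed_sets_exist (X T : V) :
  exists E, forall C, C ∈ E <-> is_closed X T C /\ nonempty C.
Proof.
  destruct (zf_powerset HZF X) as [P HP].
  destruct (zf_separation HZF (FAnd (f_closed 1 2 0) (f_nonempty 0))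
    (scons X (fun _ => T)) P) as [E HE].
  change (forall C, C ∈ E <-> C ∈ P /\ is_closed X T C /\ nonempty C) in HE.
  exists E; intro C; rewrite (HE C), (HP C); unfold is_closed; tauto.
Qed.

End ZFTheory.

Theorem proposition2p1 (V : set_structure) (HZF : ZF V)
    (X T A TA : V)
    (HT : is_topology X T)
    (HLoeb : is_Loeb X T)
    (HA : is_Fsigma X T A)
    (HTA : is_subspace_topology A T TA) :
  is_Loeb A TA.
Proof.
  destruct HLoeb as [D [HD [f Hf]]].
  destruct HA as [F [[w [g [Hw [Hg [Hgw Hginj]]]]] [HFcl HAF]]].
  destruct (nonempty_closed_sets_exist HZF A TA) as [E HE].
  exists E; split; [exact HE |].
  apply (choice_function_of_selects HZF (F := F) (g := g) (f := f)).
  - intros C HC; apply HE in HC; destruct HC as [HCcl [z Hz]].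
    apply (selects_exists HZF (w := w) (D := D) Hg Hgw (proj1 Hf)).
    + intros K B HK [y [HyK HyC]] HB; apply HD; split.
      * apply (closed_inter_subspace HZF (C := C) HT HTA (HFcl K HK));
          try assumption.
        intros x Hx; apply HAF; exists K; auto.
      * exists y; apply HB; auto.
    + assert (HzA : z ∈ A) by exact (proj1 HCcl z Hz).
      apply HAF in HzA; destruct HzA as [K [HK HzK]].
      exists K; split; [exact HK | exists z; auto].
  - intros C c c'; exact (selects_unique HZF Hw Hgw Hginj (proj1 Hf)).
  - intros C c; exact (selects_mem Hf).
Qed.
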